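(* Let $\hat f:\mathbb{Z}^2\to\mathbb{H}^3$, with unit normal $\hat n:\mathbb{Z}^2\to\mathbb{S}^{2,1}$, be a discrete surface with constant discrete Gaussian curvature $K\equiv 1$ given by the Weierstrass-type representation with $t=0$ described in the context, such that all horizontal edges have principal curvatures with absolute value greater than $1$, i.e. $|\kappa_{(m,n),(m+1,n)}|>1$ for all $(m,n)\in\mathbb{Z}^2$. Then for every $(m,n)\in\mathbb{Z}^2$ the inequality $$\kappa_{(m-1,n),(m,n)}\cdot\kappa_{(m,n),(m+1,n)}\le 0$$ holds if and only if $(m,n)$ is a singular vertex of $\hat f$ in the caustic sense, i.e. the vertex $\hat f_{(m,n)}$ lies on the edge of the discrete caustic of $\hat f$ joining the two caustic points $C_{(m-1,n),(m,n)}$ and $C_{(m,n),(m+1,n)}$.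
   Context: Minkowski space $\mathbb{R}^{3,1}$ (signature $(-,+,+,+)$) is identified with Hermitian $2\times 2$ matrices via $(x_0,x_1,x_2,x_3)\mapsto X=\begin{pmatrix} x_0+x_3 & x_1-ix_2\\ x_1+ix_2 & x_0-x_3\end{pmatrix}$, so $\langle X,X\rangle=-\det X$. $\mathbb{H}^3=\{\langle X,X\rangle=-1\}$ and $\mathbb{S}^{2,1}=\{\langle X,X\rangle=1\}$. A quadrilateral of $\mathbb{Z}^2$ has vertices $i=(m,n)$, $j=(m+1,n)$, $k=(m+1,n+1)$, $\ell=(m,n+1)$; $ij$ is a horizontal edge and $i\ell$ a vertical edge. For any function $u$ on vertices and any edge $i*$, $du_{i*}=u_*-u_i$. A discrete holomorphic function is $g:\mathbb{Z}^2\to\mathbb{C}$ with $$\frac{(g_i-g_j)(g_k-g_\ell)}{(g_j-g_k)(g_\ell-g_i)}=\frac{\alpha_{ij}}{\alpha_{i\ell}}<0$$ on all quadrilaterals, where the real-valued cross ratio factorizing function $\alpha$ on edges satisfies $\alpha_{ij}=\alpha_{\ell k}$ and $\alpha_{i\ell}=\alpha_{jk}$; it is assumed that $dg\ne0$ on all edges. Weierstrass-type representation with $t=0$: let $\lambda\in\mathbb{R}\setminus\{0\}$ with $1-\lambda\alpha\neq 0$ on all edges, let $E:\mathbb{Z}^2\to\mathrm{SL}_2\mathbb{C}$ solve $E_i^{-1}E_*=\frac{1}{\sqrt{1-\lambda\alpha_{i*}}}\begin{pmatrix}1&dg_{i*}\\ \lambda\alpha_{i*}/dg_{i*}&1\end{pmatrix}$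 for $*=j,\ell$, and let $L=\begin{pmatrix}0&1\\-1&0\end{pmatrix}$, $\hat f_i=E_iL\,\overline{E_iL}^{t}$, $\hat n_i=E_iL\begin{pmatrix}1&0\\0&-1\end{pmatrix}\overline{E_iL}^{t}$. The principal curvatures on edges satisfy $d\hat n_{i*}=-\kappa_{i*}d\hat f_{i*}$ and are given by $$\kappa_{i*}=\frac{-|dg_{i*}|^2+\lambda\alpha_{i*}}{|dg_{i*}|^2+\lambda\alpha_{i*}}.$$ Discrete caustic: for an edge $pq$ with $|\kappa_{pq}|>1$, the normal geodesics $s\mapsto\cosh s\,\hat f_p+\sinh s\,\hat n_p$ and $s\mapsto\cosh s\,\hat f_q+\sinh s\,\hat n_q$ meet at equal signed distance $s$ from $\hat f_p$ and $\hat f_q$, where $\coth s=\kappa_{pq}$; the common point is the caustic point $C_{pq}$. For three consecutive vertices $p_-,p,p_+$ in the horizontal direction, $C_{p_-p}$ and $C_{pp_+}$ both lie on the normal geodesic at $\hat f_p$, and the geodesic segment of this normal geodesic joining them is the corresponding edge of the discrete caustic. *)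

(* Defs.v *)
From HB Require Import structures.
From mathcomp Require Import all_boot all_order all_algebra.
From mathcomp Require Import reals sequences exp.
From mathcomp Require Import complex ring.

Set Implicit Arguments.
Unset Strict Implicit.
Unset Printing Implicit Defensive.

Import Order.TTheory GRing.Theory Num.Theory.

Local Open Scope ring_scope.
Local Open Scope complex_scope.
Local Open Scope sesquilinear_scope.

Notation vertex := (int * int)%type.

Definition right (p : vertex) : vertex := (p.1 + 1, p.2).
Definition up (p : vertex) : vertex := (p.1, p.2 + 1).

(* Edges carry the orientation of increasing coordinates; functions on edges
   are functions of the two endpoints, used on such pairs only. *)
Definition edge (p q : vertex) : Prop := q = right p \/ q = up p.

Section Representation.
Variable R : realType.

Definition cosh (s : R) : R := (expR s + expR (- s)) / 2.
Definition sinh (s : R) : R := (expR s - expR (- s)) / 2.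
(* coth 0 = 0 by the convention x / 0 = 0; harmless below, where coth s is
   only ever equated with a number of absolute value > 1. *)
Definition coth (s : R) : R := cosh s / sinh s.

Definition mx2 (a b c d : R[i]) : 'M[R[i]]_2 :=
  \matrix_(i < 2, j < 2)
    if i == 0 then (if j == 0 then a else b) else (if j == 0 then c else d).

(* R^{3,1} as Hermitian 2 x 2 matrices, with <X, X> = - det X. *)
Definition minkowski (X : 'M[R[i]]_2) : Prop := X ^t* = X.
Definition minkowski_sq (X : 'M[R[i]]_2) : R[i] := - \det X.
Definition H3 (X : 'M[R[i]]_2) : Prop := minkowski X /\ minkowski_sq X = -1.
Definition S21 (X : 'M[R[i]]_2) : Prop := minkowski X /\ minkowski_sq X = 1.

Definition cross_ratio (a b c d : R[i]) : R[i] :=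
  ((a - b) * (c - d)) / ((b - c) * (d - a)).

Definition factorizing (alpha : vertex -> vertex -> R) : Prop :=
  forall p, alpha p (right p) = alpha (up p) (up (right p)) /\
            alpha p (up p) = alpha (right p) (up (right p)).

Definition discrete_holomorphic
    (g : vertex -> R[i]) (alpha : vertex -> vertex -> R) : Prop :=
  [/\ factorizing alpha,
      (forall p q, edge p q -> g q - g p != 0) &
      forall p,
        cross_ratio (g p) (g (right p)) (g (up (right p))) (g (up p))
          = (alpha p (right p) / alpha p (up p))%:C
        /\ alpha p (right p) / alpha p (up p) < 0].

(* sqrtC is the principal root, since 1 - lambda * alpha may be negative. *)
Definition transition (lambda : R) (g : vertex -> R[i])
    (alpha : vertex -> vertex -> R) (p q : vertex) : 'M[R[i]]_2 :=
  (sqrtC ((1 - lambda * alpha p q)%:C))^-1 *: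
    mx2 1 (g q - g p) ((lambda * alpha p q)%:C / (g q - g p)) 1.

Definition weierstrass_frame (lambda : R) (g : vertex -> R[i])
    (alpha : vertex -> vertex -> R) (E : vertex -> 'M[R[i]]_2) : Prop :=
  (forall p, \det (E p) = 1) /\
  (forall p q, edge p q ->
     invmx (E p) *m E q = transition lambda g alpha p q).

Definition L : 'M[R[i]]_2 := mx2 0 1 (-1) 0.

Definition fhat (E : vertex -> 'M[R[i]]_2) (p : vertex) : 'M[R[i]]_2 :=
  (E p *m L) *m (E p *m L) ^t*.

Definition nhat (E : vertex -> 'M[R[i]]_2) (p : vertex) : 'M[R[i]]_2 :=
  (E p *m L) *m mx2 1 0 0 (-1) *m (E p *m L) ^t*.

(* If the denominator vanishes (an edge on which fhat is degenerate), the value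
   is 0, so that 1 < `|kappa| excludes this case. *)
Definition kappa (lambda : R) (g : vertex -> R[i])
    (alpha : vertex -> vertex -> R) (p q : vertex) : R :=
  (- Normc.normc (g q - g p) ^+ 2 + lambda * alpha p q)
  / (Normc.normc (g q - g p) ^+ 2 + lambda * alpha p q).

Definition normal_geodesic (f n : vertex -> 'M[R[i]]_2) (p : vertex) (s : R) :
    'M[R[i]]_2 :=
  (cosh s)%:C *: f p + (sinh s)%:C *: n p.

Definition caustic_point (f n : vertex -> 'M[R[i]]_2)
    (k : vertex -> vertex -> R) (p q : vertex) (C : 'M[R[i]]_2) : Prop :=
  exists s : R, [/\ coth s = k p q,
    C = normal_geodesic f n p s & C = normal_geodesic f n q s].

Definition normal_segment (f n : vertex -> 'M[R[i]]_2) (p : vertex)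
    (A B X : 'M[R[i]]_2) : Prop :=
  exists a b s : R, [/\ A = normal_geodesic f n p a,
    B = normal_geodesic f n p b, X = normal_geodesic f n p s &
    Num.min a b <= s <= Num.max a b].

Definition singular_vertex (f n : vertex -> 'M[R[i]]_2)
    (k : vertex -> vertex -> R) (p : vertex) : Prop :=
  exists A B : 'M[R[i]]_2,
    [/\ caustic_point f n k (p.1 - 1, p.2) p A,
        caustic_point f n k p (right p) B &
        normal_segment f n p A B (f p)].

Lemma ord2E (i : 'I_2) : i = 0 \/ i = 1.
Proof. by case: i => [[|[|//]]] p; [left|right]; apply/val_inj. Qed.

Lemma mx2P (A B : 'M[R[i]]_2) :
  A 0 0 = B 0 0 -> A 0 1 = B 0 1 -> A 1 0 = B 1 0 -> A 1 1 = B 1 1 -> A = B.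
Proof.
move=> e00 e01 e10 e11; apply/matrixP=> i j.
by case: (ord2E i) => ->; case: (ord2E j) => ->.
Qed.

Lemma mul_mx2 a b c d a' b' c' d' :
  mx2 a b c d *m mx2 a' b' c' d' =
  mx2 (a * a' + b * c') (a * b' + b * d') (c * a' + d * c') (c * b' + d * d').
Proof. by apply: mx2P; rewrite !mxE !big_ord_recl big_ord0 !mxE /= addr0. Qed.

Lemma adj_mx2 a b c d :
  (mx2 a b c d) ^t* = mx2 (Num.conj a) (Num.conj c) (Num.conj b) (Num.conj d).
Proof. by apply: mx2P; rewrite !mxE. Qed.

Lemma det_mx2 a b c d : \det (mx2 a b c d) = a * d - b * c.
Proof.
rewrite (expand_det_row _ 0) !big_ord_recl big_ord0 /cofactor !det_mx11 !mxE /=.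
by rewrite addr0 expr0 expr1 mul1r mulN1r mulrN.
Qed.

Lemma det_adj (A : 'M[R[i]]_2) : \det (A ^t*) = Num.conj (\det A).
Proof. by rewrite det_map_mx det_tr. Qed.

Lemma adjM (A B : 'M[R[i]]_2) : (A *m B) ^t* = B ^t* *m A ^t*.
Proof. by rewrite trmx_mul map_mxM. Qed.

Lemma fhat_H3 (E : vertex -> 'M[R[i]]_2) p : \det (E p) = 1 -> H3 (fhat E p).
Proof.
move=> dE; split; first by rewrite /minkowski /fhat (adjM (_ *m _)) trmxCK.
rewrite /minkowski_sq /fhat det_mulmx det_adj !det_mulmx dE det_mx2.
have -> : 0 * 0 - 1 * -1 = 1 :> R[i] by ring.
by rewrite mul1r rmorph1 mulr1.
Qed.

Lemma nhat_S21 (E : vertex -> 'M[R[i]]_2) p : \det (E p) = 1 -> S21 (nhat E p).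
Proof.
move=> dE; split.
  rewrite /minkowski /nhat (adjM (_ *m _ *m _)) trmxCK (adjM (_ *m _)) mulmxA.
  by rewrite adj_mx2 !(rmorph0, rmorphN, rmorph1).
rewrite /minkowski_sq /nhat det_mulmx det_adj !det_mulmx dE !det_mx2.
have -> : 0 * 0 - 1 * -1 = 1 :> R[i] by ring.
by rewrite !mul1r rmorph1 !mulr1 mul0r subr0 opprK.
Qed.

Lemma normcE (z : R[i]) : (Normc.normc z ^+ 2)%:C = z * Num.conj z.
Proof. by rewrite -normCK rmorphXn. Qed.

Lemma kappa_principal lambda g alpha E p q :
  weierstrass_frame lambda g alpha E -> edge p q -> g q - g p != 0 ->
  0 < 1 - lambda * alpha p q ->
  Normc.normc (g q - g p) ^+ 2 + lambda * alpha p q != 0 ->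
  nhat E q - nhat E p
    = - (kappa lambda g alpha p q)%:C *: (fhat E q - fhat E p).
Proof.
move=> [dE hE] epq dg0 pos den0.
have Eu r : E r \in unitmx by rewrite unitmxE dE unitr1.
have {hE}Eq : E q = E p *m transition lambda g alpha p q.
  by rewrite -(hE _ _ epq) mulKVmx.
have fE r : fhat E r = E r *m mx2 1 0 0 1 *m (E r) ^t*.
  rewrite /fhat adjM !mulmxA -(mulmxA (E r)); congr (_ *m _ *m _).
  by rewrite /L adj_mx2 mul_mx2 !(rmorph0, rmorph1, rmorphN); congr mx2; ring.
have nE r : nhat E r = E r *m mx2 (-1) 0 0 1 *m (E r) ^t*.
  rewrite /nhat adjM !mulmxA -(mulmxA (E r)) -(mulmxA (E r)); congr (_ *m _ *m _).
  by rewrite /L adj_mx2 !mul_mx2 !(rmorph0, rmorph1, rmorphN); congr mx2; ring.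
rewrite !fE !nE Eq; set U := transition _ _ _ _ _.
have EU N : E p *m U *m N *m (E p *m U) ^t* = E p *m (U *m N *m U ^t*) *m (E p) ^t*.
  by rewrite adjM !mulmxA.
rewrite !EU -!mulmxBl -!mulmxBr scalemxAl scalemxAr; congr (_ *m _ *m _).
rewrite /U /transition /kappa; move: pos den0 dg0.
set d := g q - g p; set a := lambda * alpha p q; set c := sqrtC _.
move=> pos den0 dg0.
have ccE : c * Num.conj c = 1 - a%:C.
  rewrite -normCK -normrX sqrtCK ger0_norm ?rmorphB ?rmorph1 //.
  by rewrite -(rmorph1 (real_complex R)) -rmorphB ler0c ltW.
have cj0 : Num.conj d != 0 by rewrite fmorph_eq0.
have dn0 : d * Num.conj d + a%:C != 0.
  by rewrite -normcE -rmorphD fmorph_eq0.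
have a0 : 1 - a%:C != 0.
  by rewrite -(rmorph1 (real_complex R)) -rmorphB fmorph_eq0 gt_eqF.
have ja : Num.conj (a%:C) = a%:C :> R[i] by exact: conjc_real.
have UU N : (c^-1 *: mx2 1 d (a%:C / d) 1) *m N *m (c^-1 *: mx2 1 d (a%:C / d) 1)^t*
  = (1 - a%:C)^-1 *: (mx2 1 d (a%:C / d) 1 *m N *m (mx2 1 d (a%:C / d) 1)^t*).
  rewrite linearZ map_mxZ /= -!scalemxAl -scalemxAr scalerA fmorphV /=.
  by rewrite -invfM ccE.
set k := (_ / _ : R)%:C.
have -> : k = (- (d * Num.conj d) + a%:C) / (d * Num.conj d + a%:C).
  by rewrite -normcE -rmorphN -!rmorphD -fmorph_div.
rewrite !UU adj_mx2 fmorph_div /= ja !rmorph1 !mul_mx2.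
clearbody d a; move: (Num.conj d) (a%:C) cj0 dn0 a0 => e b e0 n0 b0.
by apply: mx2P; rewrite !mxE /=; field; rewrite ?e0 ?dg0 ?n0 ?b0.
Qed.
End Representation.

(* Main.v *)
Require Import Defs.
From mathcomp Require Import all_boot all_order all_algebra.
From mathcomp Require Import reals sequences exp.
From mathcomp Require Import complex.
From mathcomp Require Import ring lra.

Import Order.TTheory GRing.Theory Num.Theory.
Local Open Scope ring_scope.

(** With [M := E p *m L], the normal geodesic at the vertex [p] is
    [M *m diag (e^s, e^-s) *m M^*]; as [M] is invertible, a point of the geodesic
    determines its parameter [s] ([normal_geodesic_inj]), and [fhat E p] is the
    point of parameter [0].

    The condition [1 < `|kappa|] on an edge forces [lambda * alpha < 0]
    ([kappa_gt1]), hence [1 - lambda * alpha > 0], so that the Rodrigues formula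
    [d nhat = - kappa d fhat] of [kappa_principal] is available.  Together with
    [coth s = kappa], that is [cosh s = kappa * sinh s], it gives
    [cosh s d fhat + sinh s d nhat = 0]: the two normal geodesics of the edge meet
    at the parameter [s], which exists because [coth] takes every value outside
    [[-1, 1]] ([coth_surj]).

    At a vertex, the two caustic points therefore sit at the parameters [a] and [b]
    with [coth a] and [coth b] the two curvatures, and the vertex lies between them
    exactly when [0] is between [a] and [b], that is when [a * b <= 0].  Since
    [coth s] has the sign of [s], this is the nonpositivity of the product of the
    curvatures. *)

Section Coth.
Variable R : realType.
Implicit Types s k : R.

(** [sinh] is increasing through [0], and [cosh] is positive. *)
Lemma sgr_coth s : Num.sg (coth s) = Num.sg s.
Proof.
have cosh_gt0 : 0 < cosh s by rewrite /cosh divr_gt0 // addr_gt0 ?expR_gt0.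
rewrite /coth sgrM sgrV (gtr0_sg cosh_gt0) mul1r /sinh.
have [s_gt0|s_lt0|->] := ltrgt0P s; last by rewrite oppr0 subrr mul0r.
- rewrite !gtr0_sg // divr_gt0 // subr_gt0 ltr_expR; lra.
- rewrite !ltr0_sg // pmulr_llt0 ?invr_gt0 // subr_lt0 ltr_expR; lra.
Qed.

Lemma coshE s : coth s != 0 -> cosh s = coth s * sinh s.
Proof.
rewrite /coth => coth_neq0; rewrite divfK //.
by apply: contraNneq coth_neq0 => ->; rewrite invr0 mulr0.
Qed.

Lemma coth_surj k : 1 < `|k| -> exists s, coth s = k.
Proof.
move=> k_gt1.
have k1_neq0 : k - 1 != 0.
  by apply: contraTneq k_gt1 => /subr0_eq ->; rewrite normr1 ltxx.
have ratio_gt0 : 0 < (k + 1) / (k - 1).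
  have [k_gt1'|k_ltN1] : 1 < k \/ k < -1.
    by move: k_gt1; rewrite ltr_normr => /orP[]; [left|right; lra].
  - by rewrite divr_gt0 //; lra.
  - by rewrite -mulrNN -invrN divr_gt0 //; lra.
(* coth s = (e^2s + 1) / (e^2s - 1), solved for e^2s *)
exists (ln ((k + 1) / (k - 1)) / 2).
set s := _ / 2.
have exp2 : expR s * expR s = (k + 1) / (k - 1).
  rewrite -expRD; have -> : s + s = ln ((k + 1) / (k - 1)) by rewrite /s; field.
  by rewrite lnK.
have exp_neq0 : expR s != 0 by rewrite gt_eqF ?expR_gt0.
have expB : expR s * expR s - 1 != 0.
  have -> : expR s * expR s - 1 = 2 / (k - 1) by rewrite exp2; field.
  by rewrite mulf_neq0 ?invr_eq0 ?pnatr_eq0.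
have cothE : coth s = (expR s * expR s + 1) / (expR s * expR s - 1).
  by rewrite /coth /cosh /sinh expRN; field; rewrite exp_neq0 expB.
rewrite cothE exp2; field.
have -> : k + 1 + -1 * (k - 1) = 2 by ring.
by rewrite k1_neq0 pnatr_eq0.
Qed.

End Coth.

Lemma min_le0_max (R : realDomainType) (a b : R) :
  (Num.min a b <= 0 <= Num.max a b) = (a * b <= 0).
Proof.
rewrite ge_min le_max.
case: (ltrgt0P a) => ha; case: (ltrgt0P b) => hb;
  rewrite ?ha ?hb ?mul0r ?mulr0 ?lexx //=; nra.
Qed.

Section NormalGeodesics.
Variable R : realType.
Variable E : vertex -> 'M[R[i]]_2.
Local Open Scope complex_scope.
Local Open Scope sesquilinear_scope.

Lemma normal_geodesicE p s :
  normal_geodesic (fhat E) (nhat E) p s =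
  (E p *m L R) *m mx2 (expR s)%:C 0 0 (expR (- s))%:C *m (E p *m L R) ^t*.
Proof.
have -> : mx2 (expR s)%:C 0 0 (expR (- s))%:C =
    (cosh s)%:C *: 1%:M + (sinh s)%:C *: mx2 1 0 0 (-1) :> 'M[R[i]]_2.
  by apply: mx2P; rewrite !mxE /= ?mulr0 ?addr0 // ?mulr1 ?mulrN1
    -(rmorphD, rmorphB); congr _%:C; rewrite /cosh /sinh; field.
by rewrite mulmxDr mulmxDl -!scalemxAr -!scalemxAl mulmx1.
Qed.

Lemma normal_geodesic0 p : normal_geodesic (fhat E) (nhat E) p 0 = fhat E p.
Proof.
rewrite /normal_geodesic /cosh /sinh oppr0 expR0 subrr mul0r scale0r addr0.
by have -> : (1 + 1) / 2 = 1 :> R by [field]; rewrite scale1r.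
Qed.

Lemma normal_geodesic_inj p : \det (E p) = 1 ->
  injective (normal_geodesic (fhat E) (nhat E) p).
Proof.
move=> dE s t; rewrite !normal_geodesicE.
set M := E p *m L R.
have Mu : M \in unitmx.
  by rewrite unitmxE /M det_mulmx dE det_mx2 mul0r sub0r !mul1r opprK unitr1.
have Mtu : M ^t* \in unitmx by rewrite unitmxE det_adj rmorph_unit.
move=> /(can_inj (mulmxK Mtu)) /(can_inj (mulKmx Mu)) /matrixP/(_ 0 0).
by rewrite !mxE /= => /complexI /expR_inj.
Qed.

End NormalGeodesics.

Section Caustic.
Variables (R : realType) (lambda : R) (g : vertex -> R[i]).
Variables (alpha : vertex -> vertex -> R) (E : vertex -> 'M[R[i]]_2).
Local Open Scope complex_scope.
Hypothesis hg : discrete_holomorphic g alpha.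
Hypothesis hE : weierstrass_frame lambda g alpha E.

Let k := kappa lambda g alpha.

(** For [lambda * alpha >= 0] the numerator of [kappa] is bounded by its
    denominator, by the triangle inequality. *)
Lemma kappa_gt1 p q : 1 < `|k p q| ->
  lambda * alpha p q < 0 /\
  Normc.normc (g q - g p) ^+ 2 + lambda * alpha p q != 0.
Proof.
rewrite /k /kappa; set d := _ ^+ 2; set a := lambda * _ => k_gt1.
have d_ge0 : 0 <= d by exact: sqr_ge0.
have den_neq0 : d + a != 0.
  by apply: contraTneq k_gt1 => ->; rewrite invr0 mulr0 normr0 ltr10.
split=> //; rewrite ltNge; apply: contraTN k_gt1 => a_ge0.
have den_gt0 : 0 < d + a by rewrite lt_def den_neq0 addr_ge0.
rewrite -leNgt normrM normfV (gtr0_norm den_gt0) ler_pdivrMr // mul1r.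
by rewrite ler_norml; lra.
Qed.

Lemma normal_geodesics_meet p q s : edge p q -> 1 < `|k p q| -> coth s = k p q ->
  normal_geodesic (fhat E) (nhat E) p s = normal_geodesic (fhat E) (nhat E) q s.
Proof.
move=> epq k_gt1 cothk; have [a_lt0 den_neq0] := kappa_gt1 _ _ k_gt1.
have k_neq0 : k p q != 0 by rewrite -normr_gt0 (lt_trans ltr01).
have [_ dg_neq0 _] := hg.
have pos : 0 < 1 - lambda * alpha p q by lra.
have dn := kappa_principal hE epq (dg_neq0 _ _ epq) pos den_neq0.
apply/esym/subr0_eq; rewrite /normal_geodesic opprD addrACA -!scalerBr dn.
rewrite coshE cothk // scalerA -scalerDl rmorphM /=.
by rewrite mulrN mulrC subrr scale0r.
Qed.

Lemma caustic_point_exists p q : edge p q -> 1 < `|k p q| ->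
  exists2 s, coth s = k p q &
    caustic_point (fhat E) (nhat E) k p q (normal_geodesic (fhat E) (nhat E) q s).
Proof.
move=> epq k_gt1; have [s cothk] := coth_surj _ _ k_gt1.
exists s; first exact: cothk.
exists s; split; [exact: cothk | | reflexivity].
exact: (esym (normal_geodesics_meet _ _ _ epq k_gt1 cothk)).
Qed.

(** The sign of [coth] turns the condition on the two curvatures into the
    condition that [0], the parameter of the vertex, separates the parameters of
    the two caustic points. *)
Lemma kappaM_le0_singular m n :
  1 < `|k (m - 1, n) (m, n)| -> 1 < `|k (m, n) (m + 1, n)| ->
  k (m - 1, n) (m, n) * k (m, n) (m + 1, n) <= 0
  <-> singular_vertex (fhat E) (nhat E) k (m, n).
Proof.
move=> k1_gt1 k2_gt1.
have e1 : edge (m - 1, n) (m, n) by left; rewrite /right subrK.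
have e2 : edge (m, n) (m + 1, n) by left.
have signs a b : (coth a * coth b <= 0) = (Num.min a b <= 0 <= Num.max a b).
  by rewrite min_le0_max -sgr_le0 sgrM !sgr_coth -sgrM sgr_le0.
split=> [|[A [B [[a [cotha _ Aa]] [b [cothb Bb _]]]]]].
  have [a cotha causa] := caustic_point_exists _ _ e1 k1_gt1.
  have [b cothb causb] := caustic_point_exists _ _ e2 k2_gt1.
  rewrite -cotha -cothb signs => between.
  do 2![eexists]; split; [exact: causa | exact: causb |].
  exists a, b, 0; split; [reflexivity | | | exact: between].
    exact: (esym (normal_geodesics_meet _ _ _ e2 k2_gt1 cothb)).
  exact: (esym (normal_geodesic0 _ _ _)).
have inj := normal_geodesic_inj _ _ _ (hE.1 (m, n)).
move=> [a' [b' [s [Aa' Bb' ]]]].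
rewrite -normal_geodesic0 => /inj <-.
have <- : a = a' by apply: inj; rewrite -Aa -Aa'.
have <- : b = b' by apply: inj; rewrite -Bb -Bb'.
by rewrite -signs cotha cothb.
Qed.

End Caustic.

Theorem theorem6p1 (R : realType) (g : int * int -> R[i])
    (alpha : int * int -> int * int -> R) (lambda : R)
    (E : int * int -> 'M[R[i]]_2)
    (hg : discrete_holomorphic g alpha)
    (lambda_neq0 : lambda != 0)
    (hlambda : forall p q, edge p q -> 1 - lambda * alpha p q != 0)
    (hE : weierstrass_frame lambda g alpha E)
    (hkappa : forall m n : int,
       1 < `|kappa lambda g alpha (m, n) (m + 1, n)|) :
  forall m n : int,
    kappa lambda g alpha (m - 1, n) (m, n) *
      kappa lambda g alpha (m, n) (m + 1, n) <= 0
    <-> singular_vertex (fhat E) (nhat E) (kappa lambda g alpha) (m, n).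
Proof.
move=> m n; apply: kappaM_le0_singular => //.
by have := hkappa (m - 1) n; rewrite subrK.
Qed.
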